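(* Let $\mathcal{D}$ be the period domain of polarized Hodge structures of weight $k=2$ with arbitrary Hodge numbers $h^{2,0}=h^{0,2}\ge 1$ and $h^{1,1}\ge 0$. Set $$q(2,h)=\begin{cases}\tfrac12h^{2,0}(h^{1,1}-1)+1 & \text{if } h^{2,0}>1 \text{ and } h^{1,1}\text{ is odd},\\ \tfrac12h^{2,0}h^{1,1} & \text{if } h^{2,0}>1\text{ and } h^{1,1}\text{ is even},\\ h^{1,1} & \text{if } h^{2,0}=1.\end{cases}$$ Then there exists an infinitesimal variation of Hodge structure at infinity (IVI) $(\{N_1,\dots,N_r;F^*\},\mathfrak{a})$ for $\mathcal{D}$ with $\dim_{\mathbb{C}}\mathfrak{a}=q(2,h)$.
   Context: Setting. $V_{\mathbb{R}}$ is a finite-dimensional real vector space, $V=\mathbb{C}\otimes V_{\mathbb{R}}$, $Q$ is a nondegenerate bilinear form on $V$ defined over $\mathbb{R}$ with $Q(u,v)=(-1)^kQ(v,u)$. A Hodge structure of weight $k$ is a decreasing filtration $F^*$ of $V$ with $V=F^a\oplus\overline{F^{k-a+1}}$ for all $a$; put $H^{a,k-a}=F^a\cap\overline{F^{k-a}}$. It is polarized by $Q$ if $Q(H^{a,k-a},H^{b,k-b})=0$ for $a+b\ne k$ and $Q(C\cdot,\overline{\cdot})$ is positive definite, where $Cv=i^{a-b}v$ on $H^{a,b}$. The Hodge numbers are $h^{a,k-a}=\dim H^{a,k-a}$; fix $V_{\mathbb{R}}$ and $Q$ such that polarized Hodge structures with the given Hodge numbers exist. $\mathcal{D}$ is the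 set of all such filtrations polarized by $Q$; $\check{\mathcal{D}}$ is the variety of all decreasing filtrations of $V$ of the same dimensions with $Q(F^a,F^{k-a+1})=0$. $G_{\mathbb{C}}=O(V,Q)$ has Lie algebra $\mathfrak{g}_{\mathbb{C}}$, and $\mathfrak{g}_{\mathbb{R}}$ is the Lie algebra of the subgroup preserving $V_{\mathbb{R}}$. For $F^*\in\check{\mathcal{D}}$, $F^a\mathfrak{g}_{\mathbb{C}}=\{X\in\mathfrak{g}_{\mathbb{C}}:X(F^b)\subset F^{a+b}\ \forall b\}$. Nilpotent orbits. A nilpotent orbit $\{N_1,\dots,N_r;F^*\}$ consists of $F^*\in\check{\mathcal{D}}$ and commuting nilpotent elements $N_j\in F^{-1}\mathfrak{g}_{\mathbb{C}}\cap\mathfrak{g}_{\mathbb{R}}$ such that for some $\alpha\in\mathbb{R}$, $\exp(\sum_j z_jN_j)\cdot F^*\in\mathcal{D}$ whenever $\mathrm{Im}(z_j)>\alpha$ for all $j$. The case $r=0$ (no $N_j$, and $F^*\in\mathcal{D}$) is allowed. Every $N$ in the cone $C(N_1,\dots,N_r)=\{\sum\lambda_jN_j:\lambda_j\in\mathbb{R}_{>0}\}$ ($N=0$ if $r=0$) defines the same weight filtration $W(N)_*$ (the unique increasing filtration with $N(W_l)\subset W_{l-2}$ and $N^l:\mathrm{Gr}^W_l\to\mathrm{Gr}^W_{-l}$ an isomorphism for $l\ge0$). With $W_*=W(N)[-k]_*$, where $W[-k]_j=W_{j-k}$, the pair $(W_*,F^* )$ is a mixed Hodge structure. Bigrading.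 The mixed Hodge structure $(W_*,F^* )$ has a canonical bigrading $V=\bigoplus I^{p,q}$, the unique one with $W_l=\bigoplus_{p+q\le l}I^{p,q}$, $F^p=\bigoplus_{a\ge p,\,b}I^{a,b}$ and $I^{p,q}\equiv\overline{I^{q,p}}\mod \bigoplus_{a<p,b<q}I^{a,b}$. Put $I^{a,b}\mathfrak{g}_{\mathbb{C}}=\{X\in\mathfrak{g}_{\mathbb{C}}:X(I^{p,q})\subset I^{p+a,q+b}\ \forall p,q\}$ and $\mathfrak{p}_a=\bigoplus_qI^{a,q}\mathfrak{g}_{\mathbb{C}}$. IVI. An infinitesimal variation of Hodge structure at infinity (IVI) for $\mathcal{D}$ is a pair $(\{N_1,\dots,N_r;F^*\},\mathfrak{a})$ where $\{N_1,\dots,N_r;F^*\}$ is a nilpotent orbit in $\check{\mathcal{D}}$ and $\mathfrak{a}\subset\mathfrak{p}_{-1}$ is an abelian complex subspace (any two elements commute) with $\mathrm{Span}_{\mathbb{C}}(N_1,\dots,N_r)\subset\mathfrak{a}$. Its dimension is $\dim_{\mathbb{C}}\mathfrak{a}$. *)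

(* Defs.v *)
From HB Require Import structures.
From mathcomp Require Import all_boot all_order all_algebra.
From mathcomp Require Import complex reals.

Set Implicit Arguments.
Unset Strict Implicit.
Unset Printing Implicit Defensive.

Import Order.TTheory GRing.Theory Num.Theory.
Local Open Scope ring_scope.

(* C (x)_R VR, realized as VR * VR: the pair (u, v) stands for u + i v. *)
Definition cplx (R : realType) (VR : vectType R) : Type := (VR * VR)%type.

Section Complexification.
Import VectorInternalTheory.
Variables (R : realType) (VR : vectType R).
Local Notation V := (cplx VR).
Local Notation Re := complex.Re.
Local Notation Im := complex.Im.

HB.instance Definition _ := GRing.Zmodule.copy V (VR * VR)%type.

Definition cplx_scale (c : R[i]) (x : V) : V :=
  (Re c *: x.1 - Im c *: x.2, Re c *: x.2 + Im c *: x.1).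

Fact cplx_scaleA a b x :
  cplx_scale a (cplx_scale b x) = cplx_scale (a * b) x.
Proof.
case: a b x => [a a'] [b b'] [u v]; congr pair => /=;
  rewrite !scalerBr !scalerDr !scalerBl !scalerDl !scalerA ?opprD -!addrA;
  by congr (_ + _); rewrite [RHS]addrC -addrA.
Qed.

Fact cplx_scale1 : left_id 1 cplx_scale.
Proof.
by case=> u v; congr pair; rewrite /= !scale1r scale0r ?subr0 ?addr0.
Qed.

Fact cplx_scaleDr : right_distributive cplx_scale +%R.
Proof.
move=> [a a'] [u v] [u' v']; congr pair; rewrite /= !scalerDr.
  by rewrite opprD addrACA.
by rewrite addrACA.
Qed.

Fact cplx_scaleDl x : {morph cplx_scale^~ x : a b / a + b}.
Proof.
move=> [a a'] [b b']; case: x => u v; congr pair; rewrite /= !scalerDl.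
  by rewrite opprD addrACA.
by rewrite addrACA.
Qed.

HB.instance Definition _ := GRing.Zmodule_isLmodule.Build R[i] V
  cplx_scaleA cplx_scale1 cplx_scaleDr cplx_scaleDl.

Fact cplx_vect_iso : Vector.axiom (dim VR) V.
Proof.
pose f (x : V) : 'rV[R[i]]_(dim VR) :=
  \row_j Complex (v2r x.1 0 j)
                 (v2r x.2 0 j).
pose g (w : 'rV[R[i]]_(dim VR)) : V :=
  (r2v (\row_j Re (w 0 j)),
   r2v (\row_j Im (w 0 j))).
exists f.
  move=> [a b] [u v] [u' v']; apply/rowP => j.
  rewrite !mxE.
  have e1 : ((Complex a b : R[i]) *: ((u, v) : V) + (u', v')).1
    = a *: u - b *: v + u' by [].
  have e2 : ((Complex a b : R[i]) *: ((u, v) : V) + (u', v')).2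
    = a *: v + b *: u + v' by [].
  rewrite e1 e2 !linearD /= linearN /= !linearZ /= !mxE.
  by rewrite mulrN.
exists g => [[u v]|w].
  congr pair; rewrite /= -[RHS]v2rK;
  by congr r2v; apply/rowP => j; rewrite !mxE.
apply/rowP => j; rewrite !mxE /= !r2vK !mxE.
by case: (w 0 j).
Qed.

HB.instance Definition _ := Lmodule_hasFinDim.Build R[i] V cplx_vect_iso.

Definition of_real (u : VR) : V := (u, 0).

Definition cconj (x : V) : V := (x.1, - x.2).

Definition conjv (U : {vspace V}) : {vspace V} :=
  (<<map cconj (vbasis U)>>)%VS.

Lemma cconjK : involutive cconj.
Proof. by case=> u v; rewrite /cconj /= opprK. Qed.

Lemma cconjD x y : cconj (x + y) = cconj x + cconj y.
Proof. by congr pair; rewrite /= opprD. Qed.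

Lemma cconjZ c x : cconj (c *: x) = (conjc c) *: cconj x.
Proof.
case: c x => [a b] [u v]; congr pair; rewrite /= ?scalerN ?scaleNr ?opprK //.
by rewrite opprD.
Qed.

Lemma memv_conj U x : (x \in conjv U) = (cconj x \in U).
Proof.
have sum0 : cconj 0 = 0 by congr pair; rewrite /= oppr0.
have sub (X : seq V) y : y \in <<X>>%VS -> cconj y \in <<map cconj X>>%VS.
  move=> yX; rewrite -[X]in_tupleE in yX; rewrite (coord_span yX).
  rewrite (big_morph _ cconjD sum0) memv_suml // => i _.
  rewrite cconjZ memvZ // memv_span // map_f //.
  by rewrite mem_nth.
apply/idP/idP => [/sub|xU].
  by rewrite (mapK cconjK) (span_basis (vbasisP U)).
rewrite -[x]cconjK; apply: sub.
by rewrite (span_basis (vbasisP U)).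
Qed.

End Complexification.

Section HodgeTheory.
Variables (R : realType) (VR : vectType R).
Local Notation V := (cplx VR).
Implicit Types (k : int) (h : int -> nat) (F W : int -> {vspace V}).
Implicit Types (Q : {biscalar V}) (X Y N C : 'End(V)).
Implicit Types (I : int -> int -> {vspace V}).

Definition polarization_form k Q : Prop :=
  [/\ forall u, (forall v, Q u v = 0) -> u = 0,
      forall u v : VR, Q (of_real u) (of_real v) \is Num.real
    & forall u v, Q u v = (-1) ^ k * Q v u].

(* Filtrations are finite: exhaustive and separated. *)
Definition decreasing_filtration F : Prop :=
  [/\ forall a b, a <= b -> (F b <= F a)%VS,
      exists a, F a = fullv
    & exists a, F a = 0%VS].

Definition increasing_filtration W : Prop :=
  [/\ forall a b, a <= b -> (W a <= W b)%VS,
      exists a, W a = fullv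
    & exists a, W a = 0%VS].

Definition hodge_structure k F : Prop :=
  decreasing_filtration F /\
  forall a, directv (F a + conjv (F (k - a + 1)%R)) /\
            (F a + conjv (F (k - a + 1)%R) = fullv)%VS.

(* H^{a,k-a} *)
Definition hodge_component k F (a : int) : {vspace V} :=
  (F a :&: conjv (F (k - a)%R))%VS.

Definition weil_operator k F C : Prop :=
  forall a v, v \in hodge_component k F a -> C v = 'i%C ^ (a - (k - a)) *: v.

Definition polarized k Q F : Prop :=
  (forall a b, a + b != k ->
     forall u v, u \in hodge_component k F a -> v \in hodge_component k F b ->
       Q u v = 0) /\
  exists2 C, weil_operator k F C & forall v, v != 0 -> 0 < Q (C v) (cconj v).

(* The set D; h a is the Hodge number h^{a,k-a}. *)
Definition period_domain k h Q F : Prop :=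
  [/\ hodge_structure k F,
      forall a, \dim (hodge_component k F a) = h a
    & polarized k Q F].

(* The variety D-check. *)
Definition compact_dual k h Q F : Prop :=
  [/\ decreasing_filtration F,
      exists2 F0, period_domain k h Q F0 & forall a, \dim (F a) = \dim (F0 a)
    & forall a u v, u \in F a -> v \in F (k - a + 1) -> Q u v = 0].

(* g_C, the Lie algebra of O(V, Q). *)
Definition gC Q X : Prop := forall u v, Q (X u) v + Q u (X v) = 0.

Definition gR Q X : Prop :=
  gC Q X /\ forall u : VR, exists w : VR, X (of_real u) = of_real w.

(* F^a g_C *)
Definition FgC Q F (a : int) X : Prop :=
  gC Q X /\ forall b, (X @: F b <= F (a + b)%R)%VS.

Definition lfun_pow X (n : nat) : 'End(V) := iter n (comp_lfun X) \1%VF.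

Definition nilpotent_lfun X : Prop := exists n, lfun_pow X n = 0.

Definition commuting X Y : Prop := (X \o Y = Y \o X)%VF.

(* The exponential of a nilpotent X, for which X^n = 0 once n >= dim V. *)
Definition exp_nilpotent X : 'End(V) :=
  \sum_(n < \dim {:V}) (n`!%:R)^-1 *: lfun_pow X n.

Definition act X F : int -> {vspace V} := fun a => (X @: F a)%VS.

Definition nilpotent_orbit k h Q (r : nat) (N : 'I_r -> 'End(V)) F : Prop :=
  [/\ compact_dual k h Q F,
      forall i j, commuting (N i) (N j),
      forall j, [/\ nilpotent_lfun (N j), FgC Q F (-1) (N j) & gR Q (N j)]
    & exists alpha : R, forall z : 'I_r -> R[i],
        (forall j, alpha < complex.Im (z j)) ->
        period_domain k h Q (act (exp_nilpotent (\sum_j z j *: N j)) F)].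

Definition monodromy_cone (r : nat) (N : 'I_r -> 'End(V)) X : Prop :=
  exists2 l : 'I_r -> R,
    (forall j, 0 < l j) & X = \sum_j (real_complex R (l j)) *: N j.

(* The last clause says that N^l : Gr^W_l -> Gr^W_{-l} is surjective and
   injective. *)
Definition weight_filtration N W : Prop :=
  [/\ increasing_filtration W,
      forall l, (N @: W l <= W (l - 2)%R)%VS
    & forall l : nat,
        (lfun_pow N l @: W l%:Z + W (- l%:Z - 1)%R = W (- l%:Z)%R)%VS /\
        forall v, v \in W l%:Z -> lfun_pow N l v \in W (- l%:Z - 1) ->
          v \in W (l%:Z - 1)].

(* W[-k] *)
Definition shift_filtration k W : int -> {vspace V} := fun j => W (j - k).

(* The canonical bigrading of (W, F); s lists a finite set of indices outside
   of which I vanishes, so that sums over s are sums over all (p, q). *)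
Definition canonical_bigrading W F I : Prop :=
  exists s : seq (int * int),
  [/\ uniq s /\ forall p q, (p, q) \notin s -> I p q = 0%VS,
      directv (\sum_(x <- s) I x.1 x.2) /\
      (\sum_(x <- s) I x.1 x.2 = fullv)%VS,
      forall l, W l = (\sum_(x <- s | (x.1 + x.2 <= l)%R) I x.1 x.2)%VS,
      forall p, F p = (\sum_(x <- s | (p <= x.1)%R) I x.1 x.2)%VS
    & forall p q, let L := (\sum_(x <- s | ((x.1 < p) && (x.2 < q))%R) I x.1 x.2)%VS
        in (I p q + L = conjv (I q p) + L)%VS].

(* I^{a,b} g_C *)
Definition IgC Q I (a b : int) X : Prop :=
  gC Q X /\ forall p q, (X @: I p q <= I (p + a)%R (q + b)%R)%VS.

(* p_a, the sum over q of the I^{a,q} g_C *)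
Definition frakp Q I (a : int) X : Prop :=
  exists (s : seq int) (Y : int -> 'End(V)),
    (forall q, IgC Q I a q (Y q)) /\ X = \sum_(q <- s) Y q.

(* The filtration W(N) is required to be common to all N in the cone, as it is
   for every nilpotent orbit. *)
Definition IVI k h Q (r : nat) (N : 'I_r -> 'End(V)) F
    (A : {vspace 'End(V)}) : Prop :=
  [/\ nilpotent_orbit k h Q N F,
      exists W I,
        [/\ forall X, monodromy_cone N X -> weight_filtration X W,
            canonical_bigrading (shift_filtration k W) F I
          & forall X, X \in A -> frakp Q I (-1) X],
      forall X Y, X \in A -> Y \in A -> commuting X Y
    & (<<[seq N j | j <- enum 'I_r]>> <= A)%VS].

End HodgeTheory.

(* h^{2,0} = h^{0,2} = h20 and h^{1,1} = h11, indexed by a as h^{a,2-a}. *)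
Definition hodge_numbers2 (h20 h11 : nat) (a : int) : nat :=
  if a == 1 then h11 else if (a == 0) || (a == 2) then h20 else 0%N.

(* Both halves are exact. *)
Definition q2 (h20 h11 : nat) : nat :=
  if (1 < h20)%N then
    if odd h11 then ((h20 * (h11 - 1))./2 + 1)%N else (h20 * h11)./2
  else h11.

(* Main.v *)
(* No degeneration is needed: take r = 0 and let F be any point of D, so that
   p_{-1} is g^{-1,1}.  For x in H^{0,2} and e in H^{1,1}, the skew map
   v |-> Q(x, v) e - Q(e, v) x lies in g^{-1,1}, and the maps attached to (x, e)
   and (y, f) commute as soon as Q(e, f) = 0 or x = y.  Let x run over a basis
   of H^{0,2} and e over a basis of a maximal isotropic subspace S of H^{1,1};
   when h^{1,1} is odd, add one pair (x_0, e_0) with e_0 orthogonal to S and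
   outside S.  When h^{2,0} = 1 there is a single x, and e may run over a basis
   of the whole of H^{1,1}. *)

Require Import Defs.
From HB Require Import structures.
From mathcomp Require Import all_boot all_order all_algebra.
From mathcomp Require Import complex reals.
From mathcomp Require Import ring zify.

Set Implicit Arguments.
Unset Strict Implicit.
Unset Printing Implicit Defensive.

Import Order.TTheory GRing.Theory Num.Theory.

(** * Sums of lines spanned by a finite family of vectors *)

Section LinearSpans.
Local Open Scope ring_scope.
Variables (K : fieldType) (V : vectType K) (T : finType).
Implicit Types (P : pred T) (E : T -> V).

Lemma memv_sum_lines_ind P E (p : V -> Prop) :
    p 0 -> (forall x y, p x -> p y -> p (x + y)) ->
    (forall c x, p x -> p (c *: x)) -> (forall t, P t -> p (E t)) ->
  forall x, x \in (\sum_(t | P t) <[E t]>)%VS -> p x.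
Proof.
move=> p0 pD pZ pE x /memv_sumP[u uE ->].
by apply: big_ind => // t Pt; have /vlineP[c ->] := uE t Pt; apply/pZ/pE.
Qed.

Lemma dim_sum_lines P E :
    (forall c : T -> K, \sum_t c t *: E t = 0 -> forall t, c t = 0) ->
  \dim (\sum_(t | P t) <[E t]>) = #|P|.
Proof.
move=> freeE.
have En0 t : E t != 0.
  apply/eqP => Et0; have /freeE/(_ t)/eqP : \sum_s (s == t)%:R *: E s = 0.
    rewrite (bigD1 t) //= Et0 scaler0 add0r big1 // => s /negPf->.
    by rewrite scale0r.
  by rewrite eqxx oner_eq0.
have dE : directv (\sum_(t | P t) <[E t]>).
  apply/directv_sum_independent => u uE u0.
  have [c cE] : exists c : T -> K, forall t, P t -> u t = c t *: E t.
    apply: (fin_all_exists (P := fun t d => P t -> u t = d *: E t)) => t.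
    case: (boolP (P t)) => [/uE/vlineP[d ->]|_]; first by exists d.
    by exists 0.
  (* Independence is assumed for the whole family, so a relation over [P] is extended by zero
     coefficients outside [P]. *)
  have /freeE z : \sum_t (if P t then c t else 0) *: E t = 0.
    rewrite -[RHS]u0 [RHS]big_mkcond; apply: eq_bigr => t _.
    by case: ifP => [/cE->|]; rewrite ?scale0r.
  by move=> t Pt; have := z t; rewrite Pt cE // => ->; rewrite scale0r.
rewrite (directvP dE) /= -sum1_card.
by apply: eq_bigr => t _; rewrite dim_vline En0.
Qed.

End LinearSpans.

(** * Orthogonals of finite families, and skew maps attached to pairs of vectors *)

Section BilinearForms.
Local Open Scope ring_scope.
Variables (K : fieldType) (V : vectType K) (Q : {biscalar V}).
Implicit Types (u v e x : V) (U : {vspace V}).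

Definition pairing_row n (s : n.-tuple V) v : 'rV[K]_n := \row_i Q s`_i v.

Fact pairing_row_linear n (s : n.-tuple V) : linear (pairing_row s).
Proof. by move=> c u v; apply/rowP => i; rewrite !mxE linearDr linearZr_LR. Qed.

HB.instance Definition _ n (s : n.-tuple V) :=
  GRing.isLinear.Build K V 'rV[K]_n _ (pairing_row s) (pairing_row_linear s).

Definition orthov n (s : n.-tuple V) : {vspace V} :=
  lker (linfun (pairing_row s)).

Lemma mem_orthovP n (s : n.-tuple V) v :
  reflect (forall x, x \in s -> Q x v = 0) (v \in orthov s).
Proof.
rewrite memv_ker lfunE /=; apply: (iffP eqP) => [/rowP Qv x|Qv].
  by case/tnthP=> i ->; have := Qv i; rewrite !mxE (tnth_nth 0).
by apply/rowP => i; rewrite !mxE Qv // mem_nth ?size_tuple.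
Qed.

(** Rank-nullity on [U] for the pairing map, whose image lies in a space of dimension [n]. *)
Lemma dim_cap_orthov n (s : n.-tuple V) U :
  (\dim U <= \dim (U :&: orthov s) + n)%N.
Proof.
rewrite -(limg_ker_dim (linfun (pairing_row s)) U) leq_add2l.
by rewrite (leq_trans (dimvS (subvf _))) // dimvf /dim /= mul1n.
Qed.

Definition wedge_fun x e v : V := Q x v *: e - Q e v *: x.

Fact wedge_fun_linear x e : linear (wedge_fun x e).
Proof.
move=> c u v; rewrite /wedge_fun !linearDr !linearZr_LR /= !scalerDl -!scalerA.
by rewrite scalerBr opprD addrACA.
Qed.

HB.instance Definition _ x e :=
  GRing.isLinear.Build K V V _ (wedge_fun x e) (wedge_fun_linear x e).

(* The element of so(V, Q) attached to x /\ e. *)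
Definition wedge x e : 'End(V) := linfun (wedge_fun x e).

Lemma wedgeE x e v : wedge x e v = Q x v *: e - Q e v *: x.
Proof. by rewrite lfunE. Qed.

Lemma wedge_skew x e u v : (forall a b, Q a b = Q b a) ->
  Q (wedge x e u) v + Q u (wedge x e v) = 0.
Proof.
move=> sQ; rewrite !wedgeE linearBl linearBr !linearZl_LR !linearZr_LR /=.
by rewrite (sQ u e) (sQ u x); ring.
Qed.

End BilinearForms.

(** * Isotropic subspaces of a symmetric form over an algebraically closed field *)

Section Isotropic.
Local Open Scope ring_scope.
Variables (C : numClosedFieldType) (V : vectType C) (Q : {biscalar V}).
Hypothesis sQ : forall u v, Q u v = Q v u.
Implicit Types (U : {vspace V}).

(** If [b] in [U] is not isotropic, pick a nonzero [a] in [U] orthogonal to [b]; then Q(a + t b, a +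
    t b) = Q(a, a) + t^2 Q(b, b), and a square root gives a zero in t. *)
Lemma isotropic_vector U : (1 < \dim U)%N ->
  exists v, [/\ v \in U, v != 0 & Q v v = 0].
Proof.
move=> dU; pose b := vpick U.
have bU : b \in U by apply: memv_pick.
have b0 : b != 0 by rewrite vpick0 -dimv_eq0 -lt0n ltnW.
have [Qb|Qb] := eqVneq (Q b b) 0; first by exists b.
pose W := (U :&: orthov Q [tuple b])%VS; pose a := vpick W.
have dW : (0 < \dim W)%N by have := dim_cap_orthov Q [tuple b] U; rewrite -/W; lia.
have /memv_capP[aU /mem_orthovP aW] : a \in W by apply: memv_pick.
have a0 : a != 0 by rewrite vpick0 -dimv_eq0 -lt0n.
have Qba : Q b a = 0 by apply: aW; rewrite inE.
pose t := sqrtC (- Q a a / Q b b).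
have t2 : t ^+ 2 = - Q a a / Q b b by rewrite sqrtCK.
exists (a + t *: b); split; first by rewrite memvD ?memvZ.
  apply: contra_neqN a0 => /eqP ab0.
  have : Q b (a + t *: b) = 0 by rewrite ab0 linear0r.
  rewrite linearDr linearZr_LR /= Qba add0r => /eqP.
  by rewrite mulf_eq0 (negPf Qb) orbF => /eqP t0; rewrite -ab0 t0 scale0r addr0.
rewrite linearDl !linearDr !linearZl_LR !linearZr_LR /= (sQ a b) Qba.
by rewrite !mulr0 addr0 add0r mulrA -expr2 t2 divfK // subrr.
Qed.

(** Induction on [m]. If [s] has length m and dim U is at least 2m + 2, the orthogonal of [s] in [U]
    has dimension at least m + 2, so a complement of the span of [s] in it has dimension at least 2
    and contains an isotropic vector, which extends [s]. *)
Lemma isotropic_tuple U m : (m.*2 <= \dim U)%N ->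
  exists s : m.-tuple V, [/\ free s, {subset s <= U} &
    {in s &, forall u v, Q u v = 0}].
Proof.
elim: m => [|m IH] dU; first by exists [tuple]; split=> //; rewrite nil_free.
have [|s [fs sU s0]] := IH; first by lia.
pose P := (U :&: orthov Q s)%VS.
have sP : (<<s>> <= P)%VS.
  apply/span_subvP => v vs; rewrite memv_cap sU //=.
  by apply/mem_orthovP => x xs; apply: s0.
have [|v [vD v0 Qv]] := @isotropic_vector (P :\: <<s>>)%VS.
  have := dim_cap_orthov Q s U; have := dimv_cap_compl P <<s>>%VS.
  rewrite (capv_idPr sP) -/P; have := dim_span s; rewrite size_tuple; lia.
have /memv_capP[vU /mem_orthovP vs] := subvP (diffvSl P <<s>>%VS) v vD.
exists [tuple of v :: s]; split=> /=.
- rewrite free_cons fs andbT; apply: contra v0 => vsp.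
  by rewrite -memv0 -(capv_diff P <<s>>%VS) memv_cap vD.
- by move=> x; rewrite inE => /predU1P[->|/sU].
- move=> x y; rewrite !inE => /predU1P[->|xs] /predU1P[->|ys] //.
  + by rewrite sQ vs.
  + exact: vs.
  + exact: s0.
Qed.

(** The orthogonal of [s] in [U] has dimension at least m + 1, so it is not contained in the span of
    [s], and [e] is taken in the difference. Nothing is claimed about Q(e, e). *)
Lemma isotropic_tuple_odd U m : \dim U = m.*2.+1 ->
  exists s : m.-tuple V, exists e,
    [/\ free (e :: s), {subset e :: s <= U} &
      {in s, forall u, {in e :: s, forall v, Q u v = 0}}].
Proof.
move=> dU; have [|s [fs sU s0]] := @isotropic_tuple U m; first by lia.
pose P := (U :&: orthov Q s)%VS.
have /subvPn[e] : ~~ (P <= <<s>>)%VS.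
  apply/negP => /dimvS; have := dim_cap_orthov Q s U; rewrite -/P.
  have := dim_span s; rewrite size_tuple; lia.
case/memv_capP => eU /mem_orthovP es e'; exists s, e; split.
- by rewrite free_cons e'.
- by move=> x; rewrite inE => /predU1P[->|/sU].
- move=> x xs y; rewrite inE => /predU1P[->|ys]; [exact: es|exact: s0].
Qed.

End Isotropic.

(** * Abelian spaces of skew maps and their dimension *)

Section Wedges.
Local Open Scope ring_scope.
Variables (K : fieldType) (V : vectType K) (Q : {biscalar V}).
Hypothesis sQ : forall u v, Q u v = Q v u.

(** Under the first three vanishing conditions the two composites send v to - Q(e, f) Q(y, v) x and
    to - Q(e, f) Q(x, v) y. *)
Lemma wedge_comm x e y f :
    Q x y = 0 -> Q x f = 0 -> Q e y = 0 -> Q e f = 0 \/ x = y ->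
  (wedge Q x e \o wedge Q y f = wedge Q y f \o wedge Q x e)%VF.
Proof.
move=> xy xf ey exy; apply/lfunP => v; rewrite !comp_lfunE !wedgeE.
rewrite !linearBr !linearZr_LR /= (sQ y x) (sQ y e) (sQ f e) (sQ f x).
rewrite xy xf ey !mulr0 !subr0 !scale0r !sub0r.
by case: exy => [->|xy']; rewrite ?mulr0 ?scale0r // xy'.
Qed.

Variables (n m : nat) (x : n.-tuple V) (e : m.-tuple V) (H : {vspace V}).
Hypotheses (fx : free x) (fe : free e).
Hypothesis xH : forall u, u \in <<x>>%VS -> {in H, forall v, Q u v = 0} -> u = 0.
Hypothesis eH : forall u v, u \in e -> v \in H -> Q u v = 0.

Definition wedge_span (P : pred ('I_n * 'I_m)) : {vspace 'End(V)} :=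
  (\sum_(t : 'I_n * 'I_m | P t) <[wedge Q x`_t.1 e`_t.2]>)%VS.

(** In the application [H] is H^{2,0}. On v in [H] the terms Q(e_j, v) x_i vanish, so a relation
    with coefficients c_ij becomes sum_j Q(u_j, v) e_j = 0 with u_j = sum_i c_ij x_i. Freeness of
    [e], nondegeneracy against [H] and freeness of [x] then kill all c_ij in turn. *)
Lemma dim_wedge_span (P : pred ('I_n * 'I_m)) : \dim (wedge_span P) = #|P|.
Proof.
apply: dim_sum_lines => c c0 [i j].
pose u j := \sum_i c (i, j) *: x`_i.
suff uj : u j = 0 by apply: (freeP fx) uj i.
apply: xH => [|v vH].
  by apply: memv_suml => i' _; rewrite memvZ // memv_span // mem_nth ?size_tuple.
move/lfunP/(_ v): c0; rewrite sum_lfunE zero_lfunE.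
have -> : \sum_t (c t *: wedge Q x`_t.1 e`_t.2) v = \sum_j Q (u j) v *: e`_j.
  rewrite (eq_bigr (fun t => (c (t.1, t.2) * Q x`_t.1 v) *: e`_t.2)).
    rewrite -(pair_bigA _ (fun i j => (c (i, j) * Q x`_i v) *: e`_j)) /=.
    rewrite exchange_big; apply: eq_bigr => j' _.
    rewrite -scaler_suml linear_sumlz; congr (_ *: _).
    by apply: eq_bigr => i' _; rewrite linearZl_LR.
  case=> i' j' _; rewrite scale_lfunE wedgeE (@eH e`_j') ?mem_nth ?size_tuple //.
  by rewrite scale0r subr0 scalerA.
by move/(freeP fe)/(_ j).
Qed.

Lemma wedge_span_comm (P : pred ('I_n * 'I_m)) :
    {in x &, forall u v, Q u v = 0} ->
    {in x & e, forall u v, Q u v = 0} ->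
    (forall s t, P s -> P t -> Q e`_s.2 e`_t.2 = 0 \/ s.1 = t.1) ->
  {in wedge_span P &, forall X Y, (X \o Y = Y \o X)%VF}.
Proof.
move=> xx xe PP X Y XA YA.
(* Commuting with a fixed [Z] is a linear condition, so it extends from the generators to their
   span; this is used once in each argument. *)
have comm_ind Z : (forall t, P t ->
      (wedge Q x`_t.1 e`_t.2 \o Z = Z \o wedge Q x`_t.1 e`_t.2)%VF) ->
    forall X, X \in wedge_span P -> (X \o Z = Z \o X)%VF.
  move=> ZP; apply: memv_sum_lines_ind => // [|X1 X2 E1 E2|c X1 E1].
  - by rewrite comp_lfun0l comp_lfun0r.
  - by rewrite comp_lfunDl comp_lfunDr E1 E2.
  - by rewrite -comp_lfunZl -comp_lfunZr E1.
apply: (comm_ind _ _ _ XA) => s Ps; apply/esym; apply: (comm_ind _ _ _ YA) => t Pt.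
have mem p (a : p.-tuple V) (i : 'I_p) : a`_i \in a by rewrite mem_nth ?size_tuple.
apply: wedge_comm; [exact: xx|exact: xe|by rewrite sQ; apply: xe|].
by have [->|->] := PP _ _ Pt Ps; [left|right].
Qed.

End Wedges.

(** * Hodge decomposition of a pure structure, its weight filtration and its bigrading *)

Section HodgeDecomposition.
Local Open Scope ring_scope.
Variables (R : realType) (VR : vectType R) (k : int).
Local Notation V := (cplx VR).
Variable F : int -> {vspace V}.
Hypothesis FHS : hodge_structure k F.
Local Notation H := (hodge_component k F).

Lemma hodge_componentS a : (H a <= F a)%VS.
Proof. exact: capvSl. Qed.

Lemma conjv_hodge_component a : conjv (H a) = H (k - a).
Proof.
apply/vspaceP => v; rewrite memv_conj !memv_cap !memv_conj cconjK andbC.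
by rewrite subKr.
Qed.

Lemma hodge_filtration_dec a b : a <= b -> (F b <= F a)%VS.
Proof. by case: FHS => -[dF _ _] _; apply: dF. Qed.

(** Split v in F^a along V = F^{a+1} + conj F^{k-a}. The second component differs from v by an
    element of F^{a+1}, so it lies in F^a as well, hence in H^{a,k-a}. *)
Lemma hodge_filtration_recl a : F a = (H a + F (a + 1))%VS.
Proof.
have sF : (F (a + 1) <= F a)%VS by rewrite hodge_filtration_dec ?lerDl.
apply/eqP; rewrite eqEsubv subv_add hodge_componentS sF !andbT.
apply/subvP => v vF.
have [_ full] := FHS.2 (a + 1).
have : v \in (F (a + 1) + conjv (F (k - (a + 1) + 1)))%VS by rewrite full memvf.
case/memv_addP => u uF [w wF vE]; rewrite vE addrC memv_add //.
rewrite memv_cap -{1}(addKr u w) -vE memvD ?rpredN ?(subvP sF u uF) //=.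
by have -> : k - a = k - (a + 1) + 1 by lia.
Qed.

Lemma hodge_component_cap a : (H a :&: F (a + 1) = 0)%VS.
Proof.
have [/directv_addP c0 _] := FHS.2 (a + 1).
apply/eqP; rewrite -subv0 -{}c0 subv_cap capvSr.
apply: subv_trans (capvSl _ _) _.
by have -> : k - (a + 1) + 1 = k - a; [lia|exact: capvSr].
Qed.

Lemma dim_hodge_filtration a n :
  \dim (F a) = (\sum_(i < n) \dim (H (a + i%:Z)) + \dim (F (a + n%:Z)))%N.
Proof.
elim: n => [|n IH]; first by rewrite big_ord0 addr0.
rewrite big_ord_recr /= -addnA IH; congr addn.
rewrite {1}hodge_filtration_recl dimv_disjoint_sum ?hodge_component_cap //.
by rewrite -addrA -PoszD addn1.
Qed.

Lemma hodge_component_eq0 a : F a = 0%VS \/ F (a + 1) = fullv -> H a = 0%VS.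
Proof.
case=> Fa; first by apply/eqP; rewrite -subv0 -Fa hodge_componentS.
by rewrite -(hodge_component_cap a) Fa capvf.
Qed.

Lemma hodge_filtration_range : exists (lo : int) (n : nat),
  [/\ forall a : int, a <= lo -> F a = fullv &
      forall a : int, lo + n%:Z <= a -> F a = 0%VS].
Proof.
have [[_ [lo Flo] [hi Fhi]] _] := FHS; exists lo, `|hi - lo|%N.
split=> a ale; apply/eqP.
  by rewrite eqEsubv subvf -Flo hodge_filtration_dec.
by rewrite -subv0 -Fhi hodge_filtration_dec //; lia.
Qed.

Lemma hodge_downward_ind (T : int -> Prop) :
  (forall p, F p = 0%VS -> T p) -> (forall p, T (p + 1) -> T p) -> forall p, T p.
Proof.
move=> T0 TS p; have [lo [n [_ Fhi]]] := hodge_filtration_range.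
have [d] : exists d : nat, lo + n%:Z - d%:Z <= p.
  by exists (absz (lo + n%:Z - p)%R); lia.
elim: d p => [|d IH] p hp; first by apply/T0/Fhi; lia.
by apply/TS/IH; lia.
Qed.

Definition hodge_bigrading p q : {vspace V} :=
  if p + q == k then H p else 0%VS.

(** This is W(0), whose only graded piece sits in degree 0; the shift by [k] moves that piece to
    degree [k]. *)
Definition trivial_weight (l : int) : {vspace V} := if 0 <= l then fullv else 0%VS.

Lemma weight_filtration0 : weight_filtration 0 trivial_weight.
Proof.
split.
- split; [|by exists 0|by exists (- 1)].
  move=> a b ab; rewrite /trivial_weight; case: ifP => a0; last exact: sub0v.
  by rewrite (le_trans a0 ab).
- by move=> l; apply/subvP => v /memv_imgP[u _ ->]; rewrite zero_lfunE mem0v.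
- case=> [|l].
    rewrite /trivial_weight oppr0 lexx /=; split.
      by apply/eqP; rewrite eqEsubv subvf (subv_trans _ (addvSl _ _)) // lim1g.
    by move=> v _; rewrite /lfun_pow /= id_lfunE.
  (* In positive degree the power is zero, and both graded pieces vanish: the negative steps of the
     filtration are 0, and the step just below the positive degree is already all of V. *)
  have -> : lfun_pow (0 : 'End(V)) l.+1 = 0 by rewrite /lfun_pow /= comp_lfun0l.
  split; last first.
    by move=> v _ _; rewrite /trivial_weight (_ : 0 <= _) ?memvf //; lia.
  have W_lt0 j : j < 0 -> trivial_weight j = 0%VS.
    by rewrite /trivial_weight ltNge => /negPf->.
  by rewrite lim0g add0v !W_lt0 //; lia.
Qed.

(** In the pure case the congruence modulo lower terms is an equality, since conjugation exchanges
    H^{p,q} and H^{q,p}. *)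
Lemma hodge_canonical_bigrading :
  canonical_bigrading (shift_filtration k trivial_weight) F hodge_bigrading.
Proof.
have [lo [n [Flo Fhi]]] := hodge_filtration_range.
(* The points of the antidiagonal p + q = k with lo <= p < lo + n, the range in which F can drop. *)
pose s : seq (int * int) := [seq (lo + i%:Z, k - (lo + i%:Z)) | i <- iota 0 n].
have I_s i : hodge_bigrading (lo + i%:Z) (k - (lo + i%:Z)) = H (lo + i%:Z).
  by rewrite /hodge_bigrading addrC subrK eqxx.
have mem_s (p q : int) : (p, q) \in s -> p + q = k.
  by case/mapP => i _ [-> ->]; rewrite addrC subrK.
have I0 (p q : int) : (p, q) \notin s -> hodge_bigrading p q = 0%VS.
  rewrite /hodge_bigrading; case: eqP => // pq sN; apply: hodge_component_eq0.
  (* For p < lo already F^{p+1} is all of V, and it meets [H p] trivially. *)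
  have [lo_p|] := leP lo p; last by right; apply: Flo; lia.
  have [/Fhi Fp|hi_p] := leP (lo + n%:Z) p; first by left.
  case/negP: sN; apply/mapP; exists `|p - lo|%N; first by rewrite mem_iota; lia.
  by congr pair; lia.
have sumF p : F p = (\sum_(x <- s | (p <= x.1)%R) hodge_bigrading x.1 x.2)%VS.
  apply/eqP; rewrite eqEsubv; apply/andP; split; last first.
    rewrite big_seq_cond; apply: (big_ind (fun U => U <= F p)%VS) => [|U W|].
    - exact: sub0v.
    - by rewrite subv_add => -> ->.
    case=> a b /= /andP[/mem_s ab pa]; rewrite /hodge_bigrading ab eqxx.
    exact: subv_trans (hodge_componentS _) (hodge_filtration_dec pa).
  elim/hodge_downward_ind: p => [p ->|p IH]; first exact: sub0v.
  rewrite hodge_filtration_recl subv_add; apply/andP; split; last first.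
    apply: subv_trans IH _.
    rewrite [X in (_ <= X)%VS](bigID (fun x => p + 1 <= x.1)) /=.
    apply: subv_trans (addvSl _ _).
    rewrite [X in (_ <= X)%VS](eq_bigl (fun x => p + 1 <= x.1)) //.
    by move=> x; apply: andb_idl; apply: le_trans; rewrite lerDl.
  have -> : H p = hodge_bigrading p (k - p).
    by rewrite /hodge_bigrading addrC subrK eqxx.
  have [ps|/I0->] := boolP ((p, k - p) \in s); last exact: sub0v.
  by rewrite (big_rem _ ps) /= lexx addvSl.
have sum_full : (\sum_(x <- s) hodge_bigrading x.1 x.2)%VS = fullv.
  rewrite -(Flo lo) // sumF [RHS]big_seq_cond [LHS]big_seq; apply: eq_bigl => x.
  by case: (boolP (x \in s)) => // /mapP[i _ ->] /=; rewrite lerDl.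
exists s; split.
- split=> //; rewrite map_inj_uniq ?iota_uniq // => i j [].
  by move/addrI => [].
(* Directness is a dimension count: the dimensions of the Hodge components add up to that of F^lo =
   V. *)
- split=> //; apply/directvP => /=; rewrite sum_full -(Flo lo) //.
  rewrite (dim_hodge_filtration lo n) Fhi // dimv0 addn0 big_map /=.
  rewrite -[n in iota 0 n]subn0 big_mkord.
  by apply: eq_bigr => i _; rewrite I_s.
- move=> l; rewrite /shift_filtration /trivial_weight subr_ge0.
  rewrite big_seq_cond; case: ifP => kl.
    rewrite -[LHS]sum_full [LHS]big_seq; apply: eq_bigl => -[a b] /=.
    by case: (boolP (_ \in s)) => // /mem_s->; rewrite kl.
  by rewrite big1 // => -[a b] /= /andP[/mem_s-> ]; rewrite kl.
- exact: sumF.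
- move=> p q /=; congr (_ + _)%VS; rewrite /hodge_bigrading addrC.
  case: eqP => [qp|_].
    by rewrite conjv_hodge_component; congr H; lia.
  apply/esym/eqP; rewrite -subv0; apply/subvP => v.
  rewrite memv_conj !memv0 => /eqP v0.
  by rewrite -[v]cconjK v0; apply/eqP; congr pair; rewrite /= oppr0.
Qed.

(** Reduces additive statements about F^p, such as the vanishing of [Q], to single Hodge
    components. *)
Lemma hodge_filtration_ind p (T : V -> Prop) :
    T 0 -> (forall u v, T u -> T v -> T (u + v)) ->
    (forall a u, p <= a -> u \in H a -> T u) ->
  forall u, u \in F p -> T u.
Proof.
move=> T0 TD; elim/hodge_downward_ind: p => [p Fp _ u|p IH TH u].
  by rewrite Fp memv0 => /eqP->.
rewrite hodge_filtration_recl => /memv_addP[v vH [w wF ->]].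
apply: TD; first exact: TH vH.
by apply: IH wF => a x pa; apply: TH; lia.
Qed.

End HodgeDecomposition.

(** * Points of the period domain as nilpotent orbits without monodromy *)

Section PureIVI.
Local Open Scope ring_scope.
Variables (R : realType) (VR : vectType R) (k : int) (h : int -> nat).
Local Notation V := (cplx VR).
Variables (Q : {biscalar V}) (F : int -> {vspace V}).
Hypothesis FD : period_domain k h Q F.
Local Notation H := (hodge_component k F).

Let FHS : hodge_structure k F. Proof. by case: FD. Qed.

Lemma hodge_component_orth a b u v :
  a + b != k -> u \in H a -> v \in H b -> Q u v = 0.
Proof. by case: FD => _ _ [orth _] ab; apply: orth. Qed.

(** Expanding both arguments of [Q] into Hodge components leaves pairs H^b, H^c with b >= a and c >=
    k - a + 1; then b + c > k, and these are orthogonal by polarization. *)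
Lemma period_domain_compact_dual : compact_dual k h Q F.
Proof.
split; [by case: FHS | by exists F |] => a u v uF vF.
move: u uF; apply: (hodge_filtration_ind FHS); first by rewrite linear0l.
  by move=> u u' Qu Qu'; rewrite linearDl /= Qu Qu' addr0.
move=> b u ab uH; move: v vF.
apply: (hodge_filtration_ind FHS); first by rewrite linear0r.
  by move=> v v' Qv Qv'; rewrite linearDr /= Qv Qv' addr0.
by move=> c v ac vH; apply: hodge_component_orth uH vH; lia.
Qed.

Lemma exp_nilpotent0 : exp_nilpotent (0 : 'End(V)) = \1%VF.
Proof.
(* If V = 0 the exponential series has no term at all, but its value 0 is then the identity. *)
rewrite /exp_nilpotent; case dV: (\dim {:V}) => [|n].
  apply/lfunP => v; have : v \in fullv by apply: memvf.
  have /eqP := dV; rewrite dimv_eq0 => /eqP->; rewrite memv0 => /eqP->.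
  by rewrite !linear0.
rewrite big_ord_recl big1 => [|i _].
  by rewrite addr0 fact0 invr1 scale1r.
by rewrite /lfun_pow /= comp_lfun0l scaler0.
Qed.

(* The nilpotent orbit with r = 0, for which p_{-1} is g^{-1,1}. *)
Lemma pure_IVI (A : {vspace 'End(V)}) (N : 'I_0 -> 'End(V)) :
    (forall X, X \in A -> gC Q X /\ forall a, (X @: H a <= H (a - 1))%VS) ->
    (forall X Y, X \in A -> Y \in A -> commuting X Y) ->
  IVI k h Q N F A.
Proof.
move=> AH AC; split=> //.
- split=> [|[]//|[]//|]; first exact: period_domain_compact_dual.
  (* The exponent is an empty sum, so the orbit is the point [F] for every [z], and 0 serves as the
     bound. *)
  exists 0 => z _; rewrite big_ord0 exp_nilpotent0.
  have -> // : act \1%VF F = F by apply: boolp.funext => a; apply: lim1g.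
- exists (@trivial_weight R VR), (hodge_bigrading k F); split.
  + by move=> X [l _ ->]; rewrite big_ord0; apply: weight_filtration0.
  + exact: hodge_canonical_bigrading.
  move=> X XA; have [XQ XH] := AH X XA.
  (* On the antidiagonal, lowering p by 1 raises q by 1, so [X] is of pure type (-1, 1). *)
  exists [:: 1], (fun q => if q == 1 then X else 0); split; last by rewrite big_seq1 eqxx.
  move=> q; case: eqP => [->|_]; split=> //.
  + move=> a b; rewrite /hodge_bigrading addrACA addNr addr0.
    by case: ifP => _; rewrite ?XH // limg0 sub0v.
  + by move=> u v; rewrite !zero_lfunE linear0l linear0r addr0.
  + by move=> a b; rewrite lim0g sub0v.
- by apply/span_subvP => X /mapP[[]].
Qed.

End PureIVI.

(** * Weight two: skew maps built from H^{0,2} and H^{1,1} *)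

Section WeightTwo.
Local Open Scope ring_scope.
Variables (R : realType) (VR : vectType R) (h20 h11 : nat).
Local Notation V := (cplx VR).
Variables (Q : {biscalar V}) (F : int -> {vspace V}).
Hypothesis Qpol : polarization_form 2%:Z Q.
Hypothesis FD : period_domain 2%:Z (hodge_numbers2 h20 h11) Q F.
Local Notation H := (hodge_component 2%:Z F).

Let FHS : hodge_structure 2%:Z F. Proof. by case: FD. Qed.

Let sQ u v : Q u v = Q v u.
Proof. by case: Qpol => _ _ /(_ u v) ->; rewrite -exprnP sqrrN expr1n mul1r. Qed.

Let dimH a : \dim (H a) = hodge_numbers2 h20 h11 a.
Proof. by case: FD. Qed.

Let orth a b u v : u \in H a -> v \in H b -> a + b != 2%:Z -> Q u v = 0.
Proof. by move=> uH vH ab; apply: (hodge_component_orth FD ab uH vH). Qed.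

(** H^{0,2} is orthogonal to every component except H^{2,0}, so such a [u] is orthogonal to all of
    V. *)
Lemma hodge0_nondegenerate u :
  u \in H 0 -> {in H 2, forall v, Q u v = 0} -> u = 0.
Proof.
move=> uH uH2; case: Qpol => nd _ _; apply: nd => v.
have [lo [n [Flo _]]] := hodge_filtration_range FHS.
have : v \in F lo by rewrite Flo ?memvf.
move: v; apply: (hodge_filtration_ind FHS); first by rewrite linear0r.
  by move=> v v' Qv Qv'; rewrite linearDr /= Qv Qv' addr0.
move=> a v _ vH; have [a2|a2] := eqVneq a 2; first by rewrite uH2 // -a2.
by apply: orth uH vH _; rewrite add0r.
Qed.

(** By orthogonality Q(x, .) is nonzero only on H^{2,0}, which is sent to the line of e in H^{1,1},
    and Q(e, .) only on H^{1,1}, which is sent to the line of x in H^{0,2}. *)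
Lemma wedge_hodge x e a : x \in H 0 -> e \in H 1 -> (wedge Q x e @: H a <= H (a - 1))%VS.
Proof.
move=> xH eH; apply/subvP => _ /memv_imgP[v vH ->]; rewrite wedgeE.
apply: memvB.
  have [a2|a2] := eqVneq a 2; first by rewrite a2 memvZ.
  by rewrite (orth xH vH) ?scale0r ?mem0v ?add0r.
have [a1|a1] := eqVneq a 1; first by rewrite a1 memvZ.
rewrite (orth eH vH) ?scale0r ?mem0v //.
by apply: contra a1 => /eqP; lia.
Qed.

(** Reduces the theorem to a combinatorial choice: a free family [e] in H^{1,1} and a set [P] of
    pairs, the first index running over a basis of H^{0,2}. *)
Lemma wedge_span_IVI m d (e : m.-tuple V) (P : pred ('I_h20 * 'I_m)) :
    #|P| = d -> free e -> {subset e <= H 1} ->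
    (forall s t, P s -> P t -> Q e`_s.2 e`_t.2 = 0 \/ s.1 = t.1) ->
  exists (r : nat) (N : 'I_r -> 'End(V)) (G : int -> {vspace V})
         (A : {vspace 'End(V)}),
    IVI 2%:Z (hodge_numbers2 h20 h11) Q N G A /\ \dim A = d.
Proof.
move=> <- fe eH PP.
have dx : \dim (H 0) = h20 by rewrite dimH.
pose x := tcast dx (vbasis (H 0)).
have xE : x = vbasis (H 0) :> seq V by rewrite val_tcast.
have xH : {subset x <= H 0} by move=> u; rewrite memtE xE => /vbasis_mem.
exists 0%N, (fun _ => 0), F, (wedge_span Q x e P); split; last first.
  apply: (dim_wedge_span (H := H 2)) => //.
  - by rewrite xE (basis_free (vbasisP _)).
  - move=> u; rewrite xE (span_basis (vbasisP _)); exact: hodge0_nondegenerate.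
  - by move=> u v /eH uH vH; apply: orth uH vH _.
apply: pure_IVI => // [X XA|].
  split.
    move: X XA; apply: memv_sum_lines_ind.
    - by move=> u v; rewrite !zero_lfunE linear0l linear0r addr0.
    - move=> X Y XQ YQ u v; rewrite !add_lfunE linearDl linearDr /= addrACA.
      by rewrite XQ YQ addr0.
    - move=> c X XQ u v; rewrite !scale_lfunE linearZl_LR linearZr_LR /=.
      by rewrite -mulrDr XQ mulr0.
    - by move=> t _ u v; apply: wedge_skew.
  move=> a; apply/subvP => _ /memv_imgP[v vH ->].
  move: X XA; apply: memv_sum_lines_ind.
  - by rewrite zero_lfunE mem0v.
  - by move=> X Y XH YH; rewrite add_lfunE memvD.
  - by move=> c X XH; rewrite scale_lfunE memvZ.
  - move=> t _; apply: (subvP (wedge_hodge _ _ _)); last exact: memv_img.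
      by apply: xH; rewrite mem_nth ?size_tuple.
    by apply: eH; rewrite mem_nth ?size_tuple.
apply: wedge_span_comm => // u v => [/xH uH /xH vH|/xH uH /eH vH].
  exact: orth uH vH _.
exact: orth uH vH _.
Qed.

End WeightTwo.

(** * Choice of the family and of the index set in the three cases *)

Theorem proposition1 (R : realType) (VR : vectType R)
    (Q : {biscalar (cplx VR)}%R) (h20 h11 : nat) :
  (0 < h20)%N ->
  polarization_form 2%:Z%R Q ->
  (exists F, period_domain 2%:Z%R (hodge_numbers2 h20 h11) Q F) ->
  exists (r : nat) (N : 'I_r -> 'End(cplx VR))
         (F : int -> {vspace (cplx VR)}) (A : {vspace 'End(cplx VR)}),
    IVI 2%:Z%R (hodge_numbers2 h20 h11) Q N F A /\ \dim A = q2 h20 h11.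
Proof.
move=> h20_gt0 Qpol [F FD].
have dH1 : \dim (hodge_component 2%:Z%R F 1%R) = h11 by case: FD => _ ->.
have sQ u v : Q u v = Q v u.
  by case: Qpol => _ _ /(_ u v) ->; rewrite -exprnP sqrrN expr1n mul1r.
have build := wedge_span_IVI Qpol FD.
rewrite /q2; case: ltnP => [h20_gt1|h20_le1]; last first.
  (* There is only one first index, so any two pairs share it and no isotropy is required of the
     basis of H^{1,1}. *)
  have h20E : h20 = 1 by lia.
  pose e := tcast dH1 (vbasis (hodge_component 2%:Z%R F 1%R)).
  have eE : e = vbasis (hodge_component 2%:Z%R F 1%R) :> seq _ by rewrite val_tcast.
  apply: (build _ _ e predT).
  - by rewrite card_prod !card_ord h20E mul1n.
  - by rewrite eE (basis_free (vbasisP _)).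
  - by move=> u; rewrite memtE eE => /vbasis_mem.
  - move=> s t _ _; right; apply: ord_inj.
    by have := ltn_ord s.1; have := ltn_ord t.1; lia.
case: ifP => h11_odd; last first.
  (* Even case: an isotropic family of half the dimension, with all pairs allowed. *)
  have [|s [fs sH s0]] := @isotropic_tuple _ _ Q sQ (hodge_component 2%:Z%R F 1%R) h11./2.
    by rewrite dH1; lia.
  apply: (build _ _ s predT) => // [|a b _ _].
    have hE : h11./2.*2 = h11 by lia.
    by rewrite card_prod !card_ord -{2}hE -doubleMr doubleK.
  by left; rewrite s0 ?mem_nth ?size_tuple.
have [|s [e [fes esH es0]]] :=
    @isotropic_tuple_odd _ _ Q sQ (hodge_component 2%:Z%R F 1%R) h11./2.
  by rewrite dH1; lia.
(* The second index runs over [e :: s], with [e] at position 0: members of [s] are paired with every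
   basis vector of H^{0,2}, but [e] only with the first one. *)
pose P := [pred t : 'I_h20 * 'I_h11./2.+1 | (t.2 != ord0) || (t.1 == 0 :> nat)].
have cardP : #|P| = ((h20 * (h11 - 1))./2 + 1)%N.
  (* Pairs involving [s] are counted apart from the single pair (0, 0). *)
  rewrite -(cardID [predX predT & predC1 ord0] P).
  have -> : #|[predI P & [predX predT & predC1 ord0]]| = (h20 * h11./2)%N.
    transitivity #|[predX {: 'I_h20} & predC1 (ord0 : 'I_h11./2.+1)]|.
      by apply: eq_card => -[i j]; rewrite !inE /=; case: (j == ord0); rewrite ?andbF.
    by rewrite cardX cardC1 !card_ord.
  have -> : #|[predD P & [predX predT & predC1 ord0]]| = 1.
    transitivity #|pred1 (Ordinal h20_gt0, ord0 : 'I_h11./2.+1)|; last exact: card1.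
    apply: eq_card => -[i j]; rewrite !inE /= xpair_eqE negbK.
    by case: (j == ord0); rewrite ?andbF ?andbT.
  have {2}-> : h11 = (h11./2.*2.+1)%N by lia.
  by rewrite subn1 /= -doubleMr doubleK.
apply: (build _ _ [tuple of e :: s] P) => // a b.
have in_s (i : 'I_h11./2.+1) : i != ord0 -> nth 0%R (e :: s) i \in s.
  by case: i => -[|i] //= lt_i _; rewrite mem_nth // size_tuple.
have in_es (i : 'I_h11./2.+1) : nth 0%R (e :: s) i \in e :: s.
  by rewrite mem_nth //= size_tuple.
(* If either pair involves a member of [s], that member is orthogonal to all of [e :: s]; otherwise
   both first indices are 0. *)
case/orP => [a2|/eqP a1]; first by left; apply: es0; [apply: in_s|apply: in_es].
case/orP => [b2|/eqP b1]; last by right; apply: ord_inj; rewrite a1.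
by left; rewrite sQ; apply: es0; [apply: in_s|apply: in_es].
Qed.
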